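(* Consider the Basic Independence Model and the adaptive step up test at level $\alpha$ with tuning parameter $\lambda$ ($0<\alpha<\lambda<1$), critical values $\hat\alpha_{i:n}=\left(\frac{i}{\hat n_0}\alpha\right)\wedge\lambda$, $i=1,\dots,n$, and estimator $\hat n_0=\hat n_0((\hat F_n(t))_{t\ge\lambda})>0$. Then $$FDR=\frac{\alpha}{\lambda}\cdot E\left(V(\lambda)\cdot\min\left\{\frac{1}{\hat n_0},\frac{\lambda}{R(\lambda)\alpha}\right\}\right)$$ holds (the integrand being read as $0$ when $R(\lambda)=0$, in which case $V(\lambda)=0$). Consequently, the condition $$E\left(\frac{V(\lambda)}{\hat n_0}\right)\le\lambda$$ implies $FDR\le\alpha$.
   Context: Basic Independence (BI) Model: $n\ge 1$ null hypotheses $\mathcal H_1,\dots,\mathcal H_n$; $(H_i,\xi_i)_{i\le n}$ is an arbitrary random vector with values in $(\{0,1\}\times[0,1])^n$; $U_1,\dots,U_n$ are independent, uniformly distributed on $(0,1)$, and independent of $(H_i,\xi_i)_{i\le n}$. $\mathcal H_i$ is true if $H_i=0$ and false if $H_i=1$. The $p$-values are $p_i=(1-H_i)U_i+H_i\xi_i$. Put $N_0=\sum_{i=1}^n(1-H_i)$ and assume $E(N_0)>0$. Let $\hat F_n(t)=\frac1n\sum_{i=1}^n 1\{p_i\le t\}$, $t\in[0,1]$, and let $p_{1:n}\le\dots\le p_{n:n}$ be the order statistics of the $p$-values. Notation: $a\wedge b=\min(a,b)$, $a\vee b=\max(a,b)$. Fix $0<\lambda<1$ and $0<\alpha<\lambda$.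 The estimator $\hat n_0$ is a strictly positive (finite) measurable function of $(\hat F_n(t))_{t\ge\lambda}$. Put $\hat\alpha_{0:n}=0$. Adaptive step up (SU) test: with $R=\max\{i: p_{i:n}\le\hat\alpha_{i:n}\}$ ($\max\emptyset=0$), it rejects all null hypotheses whose $p$-value is $\le\hat\alpha_{R:n}$; $R$ is the number of rejections. With $V=\sum_{i=1}^n 1\{p_i\le\hat\alpha_{R:n},H_i=0\}$, $FDR=E\left(\frac{V}{R\vee 1}\right)$. For $t\in[0,1]$: $R(t)=n\hat F_n(t)$ and $V(t)=\sum_{i=1}^n 1\{p_i\le t,H_i=0\}$. *)

(* Defs.v *)
From mathcomp Require Import all_boot all_order all_algebra.
From mathcomp Require Import all_classical all_reals all_analysis.

Set Implicit Arguments.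
Unset Strict Implicit.
Unset Printing Implicit Defensive.

Import Order.TTheory GRing.Theory Num.Theory.

Local Open Scope classical_set_scope.
Local Open Scope ring_scope.

Definition mutually_independent d d' (T : measurableType d)
    (E : measurableType d') (R : realType) (P : probability T R)
    (I : finType) (X : I -> T -> E) : Prop :=
  forall (J : {set I}) (A : I -> set E),
    (forall i, measurable (A i)) ->
    P (\bigcap_(i in [set` J]) X i @^-1` A i) =
      (\prod_(i in J) P (X i @^-1` A i))%E.

Definition independent d d1 d2 (T : measurableType d)
    (E1 : measurableType d1) (E2 : measurableType d2) (R : realType)
    (P : probability T R) (X : T -> E1) (Y : T -> E2) : Prop :=
  forall (A : set E1) (B : set E2), measurable A -> measurable B ->
    P (X @^-1` A `&` Y @^-1` B) = (P (X @^-1` A) * P (Y @^-1` B))%E.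

(* [H i w = true] encodes H_i = 1, i.e. the i-th null hypothesis is false. *)
Definition pvalue (R : realType) (T : Type) (n : nat)
    (H : 'I_n -> T -> bool) (xi U : 'I_n -> T -> R) (w : T) (i : 'I_n) : R :=
  (1 - (H i w)%:R) * U i w + (H i w)%:R * xi i w.

Definition num_true (R : realType) (T : Type) (n : nat)
    (H : 'I_n -> T -> bool) (w : T) : R :=
  \sum_(i < n) (1 - (H i w)%:R).

(* The joint law of (H_i, xi_i)_i is unrestricted; the vectors live in the
   product sigma-algebra on tuples. *)
Record basic_independence d (T : measurableType d) (R : realType)
    (P : probability T R) (n : nat) (H : 'I_n -> {RV P >-> bool})
    (xi U : 'I_n -> {RV P >-> R}) : Prop := BasicIndependence {
  bi_xi : forall i w, 0 <= xi i w <= 1;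
  bi_uniform : forall i (A : set R), measurable A ->
    distribution P (U i) A = uniform_prob (@ltr01 R) A;
  bi_indepU : mutually_independent P U;
  bi_indep : independent P
    (fun w => [tuple U i w | i < n])
    (fun w => [tuple (H i w, xi i w) | i < n]);
  bi_num_true : (0 < 'E_P[num_true R H])%E
}.

Arguments basic_independence {d T R} P {n} H xi U.

(* The following definitions are pathwise: [p] is a realisation of the
   p-values and [h] one of (H_1, .., H_n). *)

Definition ecdf (R : realType) (n : nat) (p : 'I_n -> R) (t : R) : R :=
  n%:R^-1 * \sum_(i < n) (p i <= t)%R%:R.

(* R(t) *)
Definition nreject (R : realType) (n : nat) (p : 'I_n -> R) (t : R) : R :=
  n%:R * ecdf p t.

(* V(t) *)
Definition nfalse (R : realType) (n : nat) (h : 'I_n -> bool) (p : 'I_n -> R)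
    (t : R) : R :=
  \sum_(i < n) ((p i <= t)%R && ~~ h i)%:R.

(* p_{i:n}, for 1 <= i <= n *)
Definition ostat (R : realType) (n : nat) (p : 'I_n -> R) (i : nat) : R :=
  nth 0 (sort <=%R [seq p j | j <- enum 'I_n]) i.-1.

(* Number of rejections of the step up test with critical values
   c 1, .., c n; the empty maximum is 0. *)
Definition su_nreject (R : realType) (n : nat) (c : nat -> R) (p : 'I_n -> R) :
    nat :=
  \max_(i < n | ostat p i.+1 <= c i.+1) i.+1.

Definition su_fdp (R : realType) (n : nat) (c : nat -> R) (h : 'I_n -> bool)
    (p : 'I_n -> R) : R :=
  nfalse h p (c (su_nreject c p)) / (maxn (su_nreject c p) 1)%:R.

Definition tail_path (R : realType) (lambda : R) : Type :=
  {t : R | lambda <= t <= 1} -> R.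

(* The evaluation cylinders, which generate the product sigma-algebra on
   R^[lambda, 1]. *)
Definition cylinders (R : realType) (lambda : R) :
    set (set (tail_path lambda)) :=
  [set S | exists t (B : set R),
    measurable B /\ S = (fun f : tail_path lambda => f t) @^-1` B].

Definition measurable_estimator (R : realType) (lambda : R)
    (n0 : tail_path lambda -> R) : Prop :=
  forall B : set R, measurable B -> <<s @cylinders R lambda >> (n0 @^-1` B).

Definition ecdf_tail (R : realType) (lambda : R) (n : nat) (p : 'I_n -> R) :
    tail_path lambda :=
  fun t => ecdf p (sval t).

Arguments ecdf_tail {R} lambda {n} p.

Definition adaptive_crit (R : realType) (alpha lambda n0 : R) (i : nat) : R :=
  if i == 0%N then 0 else Num.min (i%:R / n0 * alpha) lambda.

Definition FDR d (T : measurableType d) (R : realType) (P : probability T R)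
    (n : nat) (alpha lambda : R) (n0 : tail_path lambda -> R)
    (H : 'I_n -> T -> bool) (xi U : 'I_n -> T -> R) : \bar R :=
  'E_P[fun w => su_fdp
    (adaptive_crit alpha lambda (n0 (ecdf_tail lambda (pvalue H xi U w))))
    (H^~ w) (pvalue H xi U w)]%E.

(* Main.v *)
(* Let q be p with p_i replaced by 0, and let s_i be the number of rejections for
   q. As long as p_i <= lambda the estimator does not see the change, and p_i is
   rejected for p iff p_i <= c_i := alpha-hat_{s_i:n}, in which case both tests
   reject s_i hypotheses. Hence the false discovery proportion is the sum over
   true nulls of 1{p_i <= c_i} / s_i. Here c_i, s_i do not depend on U_i, so
   integrating U_i out turns 1{U_i <= c_i} / s_i into c_i / s_i, and integrating
   back gives 1{U_i <= lambda} c_i / (lambda s_i). Finally, on p_i <= lambda,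
   c_i / s_i = alpha min(1 / n0-hat, lambda / (alpha R(lambda))): either the cap
   lambda is reached, and then s_i = R(lambda), or neither s_i nor R(lambda)
   reaches it. *)
Require Import Defs.
From mathcomp Require Import all_boot all_order all_algebra.
From mathcomp Require Import all_classical all_reals all_analysis.
From mathcomp Require Import measurable_realfun ring.

Set Implicit Arguments.
Unset Strict Implicit.
Unset Printing Implicit Defensive.

Import Order.TTheory GRing.Theory Num.Theory.

Local Open Scope classical_set_scope.
Local Open Scope ring_scope.

(** * Step-up tests and leave-one-out *)

Section StepUp.
Context (R : realType) (n : nat).
Implicit Types (p : 'I_n -> R) (c : nat -> R) (t : R) (i : 'I_n).

Definition count_le p t : nat := (\sum_(i < n) (p i <= t)%R)%N.

Lemma count_le_max p t : (count_le p t <= n)%N.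
Proof.
rewrite /count_le -[leqRHS]card_ord -sum1_card.
by apply: leq_sum => i _; case: (_ <= _).
Qed.

Lemma count_le_mono p s t : s <= t -> (count_le p s <= count_le p t)%N.
Proof.
move=> st; apply: leq_sum => i _; case: (leP (p i) s) => // pis.
by rewrite (le_trans pis st).
Qed.

Lemma nrejectE p t : nreject p t = (count_le p t)%:R.
Proof.
(* For n = 0 the factor n / n is 0 instead of 1, but then the count is an empty sum. *)
rewrite /nreject /ecdf; case: (posnP n) => [n0|n_gt0].
  rewrite /count_le -natr_sum mulrA.
  have -> : (\sum_(i < n) (p i <= t)%R = 0)%N.
    by apply: big1 => i _; have := ltn_ord i; rewrite [X in (_ < X)%N]n0.
  by rewrite mulr0.
by rewrite mulrA divff ?mul1r ?natr_sum// pnatr_eq0 -lt0n.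
Qed.

(** Trades order statistics for counts, so that sorting disappears from what follows. [ostat p i.+1]
    is the entry of index i in the sorted list, hence the strict inequality. *)
Lemma ostat_le p t i : (ostat p i.+1 <= t) = (i < count_le p t)%N.
Proof.
rewrite /ostat /=; set s := sort _ _.
have ss : sorted <=%R s by exact: (sort_sorted (@le_total _ R)).
have sz : size s = n by rewrite size_sort size_map size_enum_ord.
have -> : count_le p t = count (<= t) s.
  have /permP -> : perm_eq s [seq p j | j <- enum 'I_n] by rewrite perm_sort.
  rewrite count_map -sum1_count [RHS]big_mkcond big_enum/=.
  by apply: eq_bigr => j _; case: (_ <= _).
apply/idP/idP => [|]; last exact: nth_count_le.
apply: contraTT; rewrite -leqNgt -ltNge => h.
by apply: nth_count_gt => //; rewrite h sz /=.
Qed.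

Lemma su_nrejectE c p : su_nreject c p =
  \max_(i < n) (if (i < count_le p (c i.+1))%N then i.+1 else 0%N).
Proof.
by rewrite /su_nreject big_mkcond/=; apply: eq_bigr => i _; rewrite ostat_le.
Qed.

(** Such a k is itself a candidate in the maximum; k <= n because no count exceeds n. *)
Lemma su_nreject_ge c p k : (0 < k)%N -> (k <= count_le p (c k))%N ->
  (k <= su_nreject c p)%N.
Proof.
case: k => // k _ kc; have kn := leq_trans kc (count_le_max _ _).
rewrite su_nrejectE.
by have := leq_bigmax (F := fun i : 'I_n => if (i < count_le p (c i.+1))%N
  then i.+1 else 0%N) (Ordinal kn); rewrite /= kc.
Qed.

Lemma su_nreject_le_count c p : (su_nreject c p <= count_le p (c (su_nreject c p)))%N.
Proof.
(* The inequality holds at 0 and at each candidate, and the maximum of two numbers is one of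
   them. *)
rewrite su_nrejectE; elim/big_ind : _ => // [x y hx hy|i _].
  by rewrite /maxn; case: ifP.
by case: ifP.
Qed.

Section monotone_thresholds.
Variable c : nat -> R.
Hypothesis c0 : c 0%N = 0.
Hypothesis c_mono : {homo c : k l / (k <= l)%N >-> k <= l}.

(** Let r be the number of rejections. If the count K at c r exceeded r, monotonicity of c would
    give at least K p-values below c K, so K would be a candidate larger than r. *)
Lemma count_le_su p : count_le p (c (su_nreject c p)) = su_nreject c p.
Proof.
apply/eqP; rewrite eqn_leq su_nreject_le_count andbT leqNgt; apply/negP => h.
suff : (count_le p (c (su_nreject c p)) <= su_nreject c p)%N by rewrite leqNgt h.
apply: su_nreject_ge; first exact: leq_ltn_trans h.
by apply/count_le_mono/c_mono/ltnW.
Qed.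

Definition zero_at i p : 'I_n -> R := fun j => if j == i then 0 else p j.

Lemma count_le_zero_at_ge i p t : 0 <= t ->
  (count_le p t <= count_le (zero_at i p) t)%N.
Proof.
move=> t0; apply: leq_sum => j _; rewrite /zero_at.
by case: eqVneq => // _; rewrite t0; case: (_ <= _).
Qed.

Lemma count_le_zero_at i p t : 0 <= t -> p i <= t ->
  count_le (zero_at i p) t = count_le p t.
Proof.
move=> t0 pt; apply: eq_bigr => j _; rewrite /zero_at.
by case: eqVneq => // ->; rewrite t0 pt.
Qed.

(** The zeroed coordinate lies below c 1, so rank 1 is a candidate. This makes it legitimate to
    divide by the leave-one-out number of rejections. *)
Lemma su_nreject_zero_at_gt0 i p : (0 < su_nreject c (zero_at i p))%N.
Proof.
apply: su_nreject_ge => //.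
rewrite /count_le (bigD1 i)//= /zero_at eqxx.
by rewrite -c0 c_mono.
Qed.

Let c_ge0 k : 0 <= c k. Proof. by rewrite -c0 c_mono. Qed.

(** Setting p_i to 0 can only raise counts at nonnegative thresholds, so r <= s, and p_i <= c s in
    either case. At the threshold c s the two counts then agree, which makes s a candidate for p. *)
Lemma su_nreject_zero_at i p :
  (p i <= c (su_nreject c p)) || (p i <= c (su_nreject c (zero_at i p))) ->
  su_nreject c (zero_at i p) = su_nreject c p.
Proof.
set r := su_nreject c p; set s := su_nreject c _ => h.
have rs : (r <= s)%N.
  have [->//|r0] := posnP r; apply: su_nreject_ge => //.
  by rewrite (leq_trans _ (count_le_zero_at_ge _ _ _))// count_le_su.
have {}h : p i <= c s.
  by case/orP : h => // /le_trans; apply; exact: c_mono.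
apply/eqP; rewrite eqn_leq rs andbT.
apply: su_nreject_ge; first exact: su_nreject_zero_at_gt0.
by rewrite -(count_le_zero_at _ h)// count_le_su.
Qed.

(** Either both indicators vanish, or the two numbers of rejections agree and are positive, so that
    the maximum with 1 changes nothing. *)
Lemma su_reject_zero_at i p : (p i <= c (su_nreject c p))%R%:R /
    (maxn (su_nreject c p) 1)%:R =
  (p i <= c (su_nreject c (zero_at i p)))%R%:R /
    (su_nreject c (zero_at i p))%:R :> R.
Proof.
have := su_nreject_zero_at (i := i) (p := p).
have := su_nreject_zero_at_gt0 i p.
set s := su_nreject _ (zero_at _ _) => s0.
case: (boolP (_ || _)) => [_ /(_ isT) sr|]; last first.
  by rewrite negb_or => /andP[/negbTE-> /negbTE->] _; rewrite !mul0r.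
by rewrite sr -sr (maxn_idPl s0).
Qed.

Lemma su_fdpE (h : 'I_n -> bool) p : su_fdp c h p =
  \sum_(i < n) (~~ h i)%:R * ((p i <= c (su_nreject c (zero_at i p)))%R%:R /
    (su_nreject c (zero_at i p))%:R).
Proof.
rewrite /su_fdp /nfalse mulr_suml; apply: eq_bigr => i _.
by rewrite -su_reject_zero_at andbC -mulnb natrM mulrA.
Qed.

End monotone_thresholds.

(** * Critical values capped at lambda *)

Section adaptive_crit.
Variables alpha lambda m : R.
Hypotheses (alpha0 : 0 < alpha) (lambda0 : 0 < lambda) (m0 : 0 < m).
Let c := adaptive_crit alpha lambda m.

Lemma adaptive_critE k : c k = Num.min (k%:R / m * alpha) lambda.
Proof.
rewrite /c /adaptive_crit; case: eqP => // ->.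
by rewrite !mul0r min_l// ltW.
Qed.

Lemma adaptive_crit_mono : {homo c : k l / (k <= l)%N >-> k <= l}.
Proof.
move=> k l kl; rewrite !adaptive_critE.
apply: le_min2 => //; rewrite ler_wpM2r ?(ltW alpha0)//.
by rewrite ler_wpM2r ?invr_ge0 ?(ltW m0)// ler_nat.
Qed.

Lemma adaptive_crit_le k : c k <= lambda.
Proof. by rewrite adaptive_critE ge_min lexx orbT. Qed.

Lemma adaptive_crit_ge0 k : 0 <= c k.
Proof.
rewrite adaptive_critE le_min (ltW lambda0) andbT.
by rewrite mulr_ge0 ?(ltW alpha0)// divr_ge0// ltW.
Qed.

(** Both sides are values of alpha * min(1 / m, lambda / (k * alpha)), at k = s and at k = M. If s <
    M, the critical value of rank M stays below the cap, and both minima equal 1 / m. *)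
Lemma adaptive_crit_div_su p : (0 < su_nreject c p)%N ->
  c (su_nreject c p) / (su_nreject c p)%:R =
  alpha * Num.min (1 / m) (lambda / ((count_le p lambda)%:R * alpha)).
Proof.
set s := su_nreject c p; set M := count_le p lambda => s0.
have sE : count_le p (c s) = s by apply: count_le_su; exact: adaptive_crit_mono.
have sM : (s <= M)%N.
  by rewrite -[leqLHS]sE; apply/count_le_mono/adaptive_crit_le.
have M0 : (0 < M)%N by exact: leq_trans sM.
have s0' : 0 < s%:R :> R by rewrite ltr0n.
have M0' : 0 < M%:R :> R by rewrite ltr0n.
have eqC k : (0 < k)%N ->
    c k / k%:R = alpha * Num.min (1 / m) (lambda / (k%:R * alpha)).
  move=> k0; have k0' : 0 < k%:R :> R by rewrite ltr0n.
  rewrite adaptive_critE minr_pMr ?ltW// minr_pMl ?invr_ge0 ?ltW//; congr Num.min.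
    by field; rewrite !gt_eqF.
  by field; rewrite !gt_eqF.
have [e|ne] := eqVneq s M; first by rewrite eqC// e.
have {ne}sM : (s < M)%N by rewrite ltn_neqAle ne.
rewrite eqC//.
(* Were the cap reached at rank M, c M would be lambda and M itself a candidate, against s < M. *)
have hM : (M%:R / m * alpha) < lambda.
  rewrite ltNge; apply/negP => h.
  have : (M <= s)%N.
    by apply: su_nreject_ge => //; rewrite adaptive_critE (min_idPr h).
  by rewrite leqNgt sM.
have H k : (0 < k <= M)%N -> 1 / m <= lambda / (k%:R * alpha).
  case/andP => k0 kM; have k0' : 0 < k%:R :> R by rewrite ltr0n.
  rewrite ler_pdivlMr ?mulr_gt0// (le_trans _ (ltW hM))//.
  have -> : 1 / m * (k%:R * alpha) = k%:R / m * alpha by field; rewrite gt_eqF.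
  by rewrite ler_wpM2r ?(ltW alpha0)// ler_wpM2r ?invr_ge0 ?ler_nat// ltW.
by rewrite !min_l// H ?M0 ?s0 ?leqnn// ltnW.
Qed.

End adaptive_crit.

(** For t >= lambda the indicator of coordinate i is 1 both at p_i and at 0. *)
Lemma ecdf_tail_zero_at lambda i p : 0 <= lambda -> p i <= lambda ->
  ecdf_tail lambda (zero_at i p) = ecdf_tail lambda p.
Proof.
move=> l0 pl; apply/funext => -[t /= lt1]; rewrite /ecdf_tail /ecdf /=.
have /andP[lt _] := lt1.
congr (_ * _); apply: eq_bigr => j _; rewrite /zero_at.
by case: eqVneq => // ->; rewrite (le_trans l0 lt) (le_trans pl lt).
Qed.

(** * Leave-one-out form of the adaptive test *)

Section leave_one_out.
Variables (alpha lambda : R) (n0 : tail_path lambda -> R).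
Hypotheses (alpha0 : 0 < alpha) (lambda0 : 0 < lambda).

(* [n0] is only assumed positive on realised paths; the path with p_i replaced by
   0 need not be one, hence the default value. *)
Definition loo_estimator i p : R :=
  let m := n0 (ecdf_tail lambda (zero_at i p)) in if 0 < m then m else 1.

Lemma loo_estimator_gt0 i p : 0 < loo_estimator i p.
Proof. by rewrite /loo_estimator; case: ifP. Qed.

Definition loo_nreject i p : nat :=
  su_nreject (adaptive_crit alpha lambda (loo_estimator i p)) (zero_at i p).

Definition loo_threshold i p : R :=
  adaptive_crit alpha lambda (loo_estimator i p) (loo_nreject i p).

Lemma loo_nreject_gt0 i p : (0 < loo_nreject i p)%N.
Proof.
apply: su_nreject_zero_at_gt0 => //.
by apply: adaptive_crit_mono => //; exact: loo_estimator_gt0.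
Qed.

Lemma loo_threshold_le i p : loo_threshold i p <= lambda.
Proof. by apply: adaptive_crit_le => //; exact: loo_estimator_gt0. Qed.

Lemma loo_threshold_ge0 i p : 0 <= loo_threshold i p.
Proof. by apply: adaptive_crit_ge0 => //; exact: loo_estimator_gt0. Qed.

Section realised_path.
Variable p : 'I_n -> R.
Let m := n0 (ecdf_tail lambda p).
Hypothesis m_gt0 : 0 < m.

Lemma loo_estimatorE i : p i <= lambda -> loo_estimator i p = m.
Proof.
move=> pl; rewrite /loo_estimator ecdf_tail_zero_at//; first by rewrite m_gt0.
exact: ltW.
Qed.

(** For p_i <= lambda the leave-one-out estimator equals [m]; for p_i > lambda both indicators
    vanish, since all thresholds are capped by lambda. *)
Lemma adaptive_fdpE (h : 'I_n -> bool) :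
  su_fdp (adaptive_crit alpha lambda m) h p = \sum_(i < n)
    (~~ h i)%:R / (loo_nreject i p)%:R * (p i <= loo_threshold i p)%R%:R.
Proof.
rewrite su_fdpE//; last exact: adaptive_crit_mono.
apply: eq_bigr => i _; rewrite -mulrA [in RHS](mulrC _^-1).
have [pl|pl] := leP (p i) lambda.
  by rewrite /loo_threshold /loo_nreject loo_estimatorE.
by rewrite !leNgt (le_lt_trans _ pl) ?adaptive_crit_le//
  (le_lt_trans _ pl) ?loo_threshold_le//= !mul0r.
Qed.

(** Zeroing some p_i <= lambda changes neither the count at lambda nor the estimator, so the
    quotient formula for the zeroed path can be read off on [p]. *)
Lemma loo_threshold_div i : p i <= lambda ->
  loo_threshold i p / (loo_nreject i p)%:R =
  alpha * Num.min (1 / m) (lambda / (nreject p lambda * alpha)).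
Proof.
move=> pl; rewrite nrejectE -(count_le_zero_at (ltW lambda0) pl).
rewrite -(loo_estimatorE pl) -adaptive_crit_div_su//.
- exact: loo_estimator_gt0.
- exact: loo_nreject_gt0.
Qed.

Lemma nfalse_weightE (h : 'I_n -> bool) :
  alpha / lambda * (if nreject p lambda == 0 then 0 else nfalse h p lambda *
    Num.min (1 / m) (lambda / (nreject p lambda * alpha))) =
  \sum_(i < n) lambda^-1 *
    ((~~ h i)%:R / (loo_nreject i p)%:R * loo_threshold i p) *
    (p i <= lambda)%R%:R.
Proof.
set w := Num.min _ _.
(* If no p-value is at most lambda, [nfalse] vanishes too, so the guarded integrand equals the plain
   product. *)
transitivity (alpha / lambda * (nfalse h p lambda * w)).
  congr (_ * _); case: ifPn => //; rewrite nrejectE pnatr_eq0.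
  rewrite /count_le sum_nat_eq0 => /forallP/= p0.
  rewrite /nfalse big1 ?mul0r// => i _.
  by have /eqP := p0 i; case: (p i <= lambda).
rewrite /nfalse mulr_suml mulr_sumr; apply: eq_bigr => i _.
have [pl|pl] := leP (p i) lambda; last by rewrite /= mul0r !mulr0.
rewrite mulr1 /= -[_ / _ * _]mulrA [_^-1 * loo_threshold _ _]mulrC.
by rewrite (loo_threshold_div pl) -/w; ring.
Qed.

End realised_path.
End leave_one_out.
End StepUp.

(** * Integration against an independent uniform variable *)

Section Independence.
Context d (T : measurableType d) (R : realType) (P : probability T R).

(** By uniqueness of the product measure, the law of (X, Y) is the product of the two laws; Tonelli
    then puts the integral over X inside. *)
Lemma ge0_integral_independent d1 d2 (E1 : measurableType d1)
    (E2 : measurableType d2) (X : {RV P >-> E1}) (Y : {RV P >-> E2})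
    (f : E1 * E2 -> \bar R) :
  independent P X Y -> measurable_fun setT f -> (forall z, 0 <= f z)%E ->
  (\int[P]_w f (X w, Y w) =
   \int[P]_w \int[distribution P X]_x f (x, Y w))%E.
Proof.
move=> indXY mf f0.
have mXY : measurable_fun setT (fun w => (X w, Y w)).
  by apply: measurable_fun_pair; exact: measurable_funP.
pose XY : {RV P >-> (E1 * E2)%type} := mfun_Sub (mem_set mXY).
transitivity (\int[distribution P XY]_z f z)%E.
  by rewrite ge0_integral_distribution.
transitivity (\int[distribution P X \x distribution P Y]_z f z)%E.
  apply: eq_measure_integral => A mA _; apply/esym.
  by apply: product_measure_unique => // B C mB mC; exact: indXY.
rewrite fubini_tonelli2// ge0_integral_distribution//.
  exact: measurable_fun_fubini_tonelli_G.
by move=> y; exact: integral_ge0.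
Qed.

(** The restriction of P to E and the multiple of P by P E are finite measures that agree on the
    pi-system G, hence on the sigma-algebra it generates. *)
Lemma g_sigma_algebra_independent (E : set T) (G : set (set T)) :
  measurable E -> G `<=` measurable -> setI_closed G -> G setT ->
  (forall A, G A -> P (E `&` A) = (P E * P A)%E) ->
  forall A, <<s G >> A -> P (E `&` A) = (P E * P A)%E.
Proof.
move=> mE GM GI GT indep A sGA.
have PE0 : 0 <= fine (P E) by rewrite fine_ge0.
have PEE : (P E = (NngNum PE0)%:num%:E)%E by rewrite fineK// fin_num_measure.
rewrite setIC [in RHS]PEE.
apply: (g_sigma_algebra_measure_unique G GM (fun=> setT) _ _
  (mrestr P mE) (mscale (NngNum PE0) P)) => //.
- by rewrite bigcup_const.
- by move=> B GB; rewrite /= /mrestr setIC indep// /mscale -PEE.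
- move=> _; rewrite /= /mrestr setTI.
  exact: (le_lt_trans (probability_le1 _ _) (ltry _)).
Qed.

Lemma uniform_prob_le (t : R) : 0 <= t <= 1 ->
  uniform_prob (@ltr01 R) [set u | u <= t] = t%:E.
Proof.
move=> /andP[t0 t1]; have -> : [set u | u <= t] = `]-oo, t]%classic :> set R.
  by apply/seteqP; split => x /=; rewrite in_itv.
rewrite /uniform_prob integral_uniform_pdf.
have -> : `]-oo, t] `&` `[0, 1] = `[0, t]%classic :> set R.
  apply/seteqP; split => x /=; rewrite !in_itv/=.
    by move=> [xt /andP[-> _]].
  by move=> /andP[x0 xt]; rewrite x0 xt (le_trans xt t1).
rewrite (eq_integral (cst 1%E)); last first.
  move=> x; rewrite inE/= in_itv/= /uniform_pdf => /andP[x0 xt].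
  by rewrite x0 (le_trans xt t1) subr0 invr1.
rewrite integral_cst// mul1e /= lebesgue_measure_itv/= lte_fin.
case: ltP => [_|t0']; first by rewrite -EFinB subr0.
by apply/eqP; rewrite eqe eq_le t0 t0'.
Qed.

(* Conditionally on <<s G>>, the event U <= g has probability g. *)
Lemma expectation_uniform_threshold (G : set (set T)) (U : {RV P >-> R})
    (f g : T -> R) :
  (forall A, measurable A ->
    distribution P U A = uniform_prob (@ltr01 R) A) ->
  G `<=` measurable ->
  (forall A B, measurable A -> <<s G >> B ->
    P (U @^-1` A `&` B) = (P (U @^-1` A) * P B)%E) ->
  measurable_fun (setT : set (g_sigma_algebraType G)) f ->
  measurable_fun (setT : set (g_sigma_algebraType G)) g ->
  (forall w, 0 <= f w) -> (forall w, 0 <= g w <= 1) ->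
  ('E_P[fun w => (f w * (U w <= g w)%R%:R)%R] = 'E_P[fun w => (f w * g w)%R])%E.
Proof.
move=> Uunif GM indep mf mg f0 g01; rewrite unlock.
(* The identity from T to T with the coarser sigma-algebra is a random variable [Y] independent of
   U, and f, g are measurable functions of [Y]. *)
pose S : measurableType _ := g_sigma_algebraType G.
have mid : measurable_fun (setT : set T) (idfun : T -> S).
  move=> _ B mB; rewrite setTI preimage_id.
  by apply: (smallest_sub _ GM mB); exact: sigma_algebra_measurable.
pose Y : {RV P >-> S} := mfun_Sub (mem_set mid).
pose F (z : R * S) : \bar R := (f z.2 * (z.1 <= g z.2)%R%:R)%:E.
have mF : measurable_fun setT F.
  apply/measurable_EFinP/measurable_funM; first exact: measurableT_comp.
  apply: (@measurableT_comp _ _ _ _ _ _ (fun b : bool => b%:R : R)) => //.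
  by apply: measurable_fun_ler => //; exact: measurableT_comp.
have F0 z : (0 <= F z)%E by rewrite lee_fin mulr_ge0.
have indUY : independent P U Y by move=> A B mA mB; exact: indep.
have := ge0_integral_independent indUY mF F0.
rewrite /F/= => ->; apply: eq_integral => w _.
under eq_integral do rewrite EFinM.
rewrite ge0_integralZl//; last 2 first.
- apply/measurable_EFinP.
  apply: (@measurableT_comp _ _ _ _ _ _ (fun b : bool => b%:R : R)) => //.
  exact: measurable_fun_ler.
- by rewrite lee_fin.
have mle : measurable [set u : R | u <= g w].
  by rewrite -[X in measurable X]setTI; exact: measurable_fun_ler.
(* With w fixed, the inner integral is the uniform mass of the half-line up to g w, which is g w
   because g takes values in [0, 1]. *)
have -> : (f w * g w)%:E =
    ((f w)%:E * \int[distribution P U]_u (\1_[set u | (u <= g w)%R] u)%:E)%E.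
  by rewrite integral_indic// setIT /= Uunif// uniform_prob_le// EFinM.
congr (_ * _)%E; apply: eq_integral => u _; rewrite indicE.
congr (nat_of_bool _)%:R%:E.
by apply/idP/idP; rewrite inE.
Qed.

Lemma expectation_sum_ge0 (I : finType) (X : I -> T -> R) :
  (forall i, measurable_fun setT (X i)) -> (forall i w, 0 <= X i w) ->
  ('E_P[fun w => (\sum_i X i w)%R] = \sum_i 'E_P[X i])%E.
Proof.
move=> mX X0; rewrite unlock; under eq_integral do rewrite -sumEFin.
rewrite ge0_integral_sum// => [i|i w _]; last by rewrite lee_fin.
exact/measurable_EFinP.
Qed.

End Independence.

(** * Measurability *)

Section Measurability.
Context d (S : measurableType d) (R : realType).

(** Stated for any operation, so as to cover both counts (sums) and numbers of rejections
    (maxima). *)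
Lemma measurable_fun_big (d' : measure_display) (E : measurableType d')
    (op : E -> E -> E) (idx : E) (I : Type) (s : seq I) (F : I -> S -> E) :
  (forall f g : S -> E, measurable_fun setT f -> measurable_fun setT g ->
    measurable_fun setT (fun w => op (f w) (g w))) ->
  (forall i, measurable_fun setT (F i)) ->
  measurable_fun setT (fun w => \big[op/idx]_(i <- s) F i w).
Proof.
move=> mop mF; elim: s => [|i s IHs].
  by under eq_fun do rewrite big_nil; exact: measurable_cst.
by under eq_fun do rewrite big_cons; exact: mop.
Qed.

Lemma measurable_funV_gt0 (f : S -> R) : measurable_fun setT f ->
  (forall w, 0 < f w) -> measurable_fun setT (fun w => (f w)^-1).
Proof.
(* On positive reals the inverse is the power of exponent -1, a measurable function. *)
move=> mf f0; under eq_fun do rewrite -powR_inv1 ?ltW//.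
exact: (measurableT_comp (measurable_powR (-1 : R)) mf).
Qed.

Lemma measurable_nat_of_bool (b : S -> bool) : measurable_fun setT b ->
  measurable_fun setT (fun w => nat_of_bool (b w)).
Proof. exact: (@measurableT_comp _ _ _ _ _ _ nat_of_bool). Qed.

Lemma measurable_natr (k : S -> nat) : measurable_fun setT k ->
  measurable_fun setT (fun w => (k w)%:R : R).
Proof. exact: (@measurableT_comp _ _ _ _ _ _ (fun j => j%:R : R)). Qed.

Context (n : nat) (q : S -> 'I_n -> R).
Hypothesis mq : forall i, measurable_fun setT (fun w => q w i).

Lemma measurable_count_le (c : S -> R) : measurable_fun setT c ->
  measurable_fun setT (fun w => count_le (q w) (c w)).
Proof.
move=> mc; apply: measurable_fun_big => [f g|i]; first exact: measurable_fun_addn.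
by apply: measurable_nat_of_bool; exact: measurable_fun_ler.
Qed.

Lemma measurable_su_nreject (c : S -> nat -> R) :
  (forall k, measurable_fun setT (fun w => c w k)) ->
  measurable_fun setT (fun w => su_nreject (c w) (q w)).
Proof.
move=> mc; under eq_fun do rewrite su_nrejectE.
apply: measurable_fun_big => [f g|i]; first exact: measurable_fun_maxn.
apply: measurable_fun_ifT => //.
by apply: measurable_fun_ltn => //; exact: measurable_count_le.
Qed.

Lemma measurable_estimator_comp (lambda : R) (n0 : tail_path lambda -> R) :
  measurable_estimator n0 ->
  measurable_fun setT (fun w => n0 (ecdf_tail lambda (q w))).
Proof.
move=> mn0 _ B mB; rewrite setTI.
pose e w := ecdf_tail lambda (q w).
(* Good sets: [F] is a sigma-algebra containing the cylinders, hence the whole sigma-algebra they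
   generate. *)
pose F : set (set (tail_path lambda)) := [set A | measurable (e @^-1` A)].
suff : F (n0 @^-1` B) by [].
apply: (smallest_sub _ _ (mn0 _ mB)).
  split; rewrite /F/=.
  - by rewrite preimage_set0.
  - by move=> A mA; rewrite setTD preimage_setC; exact: measurableC.
  - by move=> A mA; rewrite preimage_bigcup; exact: bigcupT_measurable.
move=> _ [t [C [mC ->]]]; rewrite /F/=.
have me : measurable_fun setT (fun w => e w t).
  apply: measurable_funM => //; apply: measurable_sum => i.
  by apply/measurable_natr/measurable_nat_of_bool; exact: measurable_fun_ler.
by rewrite -[X in measurable X]setTI; exact: me.
Qed.

Lemma measurable_adaptive_crit (alpha lambda : R) (m : S -> R) (k : S -> nat) :
  0 < alpha -> 0 < lambda -> (forall w, 0 < m w) ->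
  measurable_fun setT m -> measurable_fun setT k ->
  measurable_fun setT (fun w => adaptive_crit alpha lambda (m w) (k w)).
Proof.
move=> alpha0 lambda0 m0 mm mk; under eq_fun do rewrite adaptive_critE//.
apply: measurable_minr => //; apply: measurable_funM => //.
by apply: measurable_funM; [exact: measurable_natr|exact: measurable_funV_gt0].
Qed.

End Measurability.

(** * Measurability of the leave-one-out quantities *)

Section LeaveOneOutMeasurability.
Context d (S : measurableType d) (R : realType) (n : nat) (q : S -> 'I_n -> R).
Variables (alpha lambda : R) (n0 : tail_path lambda -> R).
Hypotheses (alpha0 : 0 < alpha) (lambda0 : 0 < lambda).
Hypothesis mn0 : measurable_estimator n0.
Variable i : 'I_n.
(** Restricting to j <> i expresses that the quantities below do not depend on p_i; [S] will carry
    the sigma-algebra generated by [loo_system]. *)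
Hypothesis mq : forall j, j != i -> measurable_fun setT (fun w => q w j).

Let mqi j : measurable_fun setT (fun w => zero_at i (q w) j).
Proof.
rewrite /zero_at; case: eqVneq => [_|ji]; first exact: measurable_cst.
exact: mq.
Qed.

Lemma measurable_loo_estimator :
  measurable_fun setT (fun w => loo_estimator n0 i (q w)).
Proof.
have mm : measurable_fun setT (fun w => n0 (ecdf_tail lambda (zero_at i (q w)))).
  exact: measurable_estimator_comp.
by apply: measurable_fun_ifT => //; exact: measurable_fun_ltr.
Qed.

Lemma measurable_loo_nreject :
  measurable_fun setT (fun w => loo_nreject alpha n0 i (q w)).
Proof.
apply: measurable_su_nreject => // k; apply: measurable_adaptive_crit => //.
  by move=> w; exact: loo_estimator_gt0.
exact: measurable_loo_estimator.
Qed.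

Lemma measurable_loo_threshold :
  measurable_fun setT (fun w => loo_threshold alpha n0 i (q w)).
Proof.
apply: measurable_adaptive_crit => //.
- by move=> w; exact: loo_estimator_gt0.
- exact: measurable_loo_estimator.
- exact: measurable_loo_nreject.
Qed.

End LeaveOneOutMeasurability.

(** * The basic independence model *)

Section BasicIndependenceModel.
Context d (T : measurableType d) (R : realType) (P : probability T R) (n : nat).
Variables (H : 'I_n -> {RV P >-> bool}) (xi U : 'I_n -> {RV P >-> R}).

Let HX w : n.-tuple (bool * R) := [tuple (H i w, xi i w) | i < n].

Let mHX : measurable_fun setT HX.
Proof.
apply/measurable_fun_tnthP => j.
rewrite (_ : _ \o _ = fun w => (H j w, xi j w)); last first.
  by apply/funext => w /=; rewrite tnth_mktuple.
by apply: measurable_fun_pair; exact: measurable_funP.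
Qed.

Let measurable_box (A : 'I_n -> set R) : (forall j, measurable (A j)) ->
  measurable [set t : n.-tuple R | forall j, A j (tnth t j)].
Proof.
move=> mA.
rewrite (_ : [set t | _] = \bigcap_(j in [set: 'I_n]) [set t | A j (tnth t j)]).
  apply: fin_bigcap_measurable; first exact: finite_finset.
  move=> j _; rewrite -[X in measurable X]setTI.
  by apply: measurable_tnth.
by apply/seteqP; split => t /= h j; [move=> _|]; exact: h.
Qed.

(* A pi-system generating the sigma-algebra of (H, xi) and the U_j, j <> i. *)
Definition loo_system (i : 'I_n) : set (set T) :=
  [set S | exists (A : 'I_n -> set R) (C : set (n.-tuple (bool * R))),
    [/\ forall j, measurable (A j), A i = setT, measurable C &
        S = [set w | forall j, A j (U j w)] `&` HX @^-1` C]].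

Lemma loo_system_measurable i : loo_system i `<=` measurable.
Proof.
move=> _ [A [C [mA _ mC ->]]]; apply: measurableI; last first.
  by rewrite -[X in measurable X]setTI; exact: mHX.
rewrite (_ : [set w | _] = \bigcap_(j in [set: 'I_n]) U j @^-1` A j).
  apply: fin_bigcap_measurable; first exact: finite_finset.
  by move=> j _; rewrite -[X in measurable X]setTI; exact: measurable_funP.
by apply/seteqP; split => t /= h j; [move=> _|]; exact: h.
Qed.

Lemma loo_system_setI i : setI_closed (loo_system i).
Proof.
move=> _ _ [A [C [mA Ai mC ->]]] [B [D [mB Bi mD ->]]].
exists (fun j => A j `&` B j), (C `&` D); split.
- by move=> j; exact: measurableI.
- by rewrite Ai Bi setTI.
- exact: measurableI.
- apply/seteqP; split => w /=; rewrite /preimage/=.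
    by move=> [[hA hC] [hB hD]]; split; [move=> j; split|].
  by move=> [hAB [hC hD]]; split; split => // j; case: (hAB j).
Qed.

Lemma loo_system_setT i : loo_system i setT.
Proof.
exists (fun=> setT), setT; split => //.
by apply/seteqP; split.
Qed.

Lemma measurable_loo_HX i :
  measurable_fun (setT : set (g_sigma_algebraType (loo_system i))) HX.
Proof.
move=> _ C mC; rewrite setTI; apply: sub_sigma_algebra.
exists (fun=> setT), C; split => //.
by apply/seteqP; split => w //= [].
Qed.

Lemma measurable_loo_U i j : j != i ->
  measurable_fun (setT : set (g_sigma_algebraType (loo_system i))) (U j).
Proof.
move=> ji _ B mB; rewrite setTI; apply: sub_sigma_algebra.
exists (fun k => if k == j then B else setT), setT; split => //.
- by move=> k; case: ifP.
- by rewrite eq_sym (negbTE ji).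
- apply/seteqP; split => w /=; rewrite /preimage/=.
    by move=> Bw; split => // k; case: eqVneq => // ->.
  by move=> [/(_ j)]; rewrite eqxx.
Qed.

Lemma measurable_loo_H i j :
  measurable_fun (setT : set (g_sigma_algebraType (loo_system i))) (H j).
Proof.
rewrite (_ : (H j : T -> bool) = fst \o ((fun t => tnth t j) \o HX)); last first.
  by apply/funext => w /=; rewrite tnth_mktuple.
apply: measurableT_comp => //.
exact: (iffLR (measurable_fun_tnthP _) (@measurable_loo_HX i)).
Qed.

Lemma measurable_loo_xi i j :
  measurable_fun (setT : set (g_sigma_algebraType (loo_system i))) (xi j).
Proof.
rewrite (_ : (xi j : T -> R) = snd \o ((fun t => tnth t j) \o HX)); last first.
  by apply/funext => w /=; rewrite tnth_mktuple.
apply: measurableT_comp => //.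
exact: (iffLR (measurable_fun_tnthP _) (@measurable_loo_HX i)).
Qed.

Hypothesis BI : basic_independence P H xi U.

(** Independence of the vector U from (H, xi) splits off C; mutual independence of the U_j, taken
    over the full index set, then factors the box. *)
Lemma prob_box (A : 'I_n -> set R) (C : set (n.-tuple (bool * R))) :
  (forall j, measurable (A j)) -> measurable C ->
  P ([set w | forall j, A j (U j w)] `&` HX @^-1` C) =
  (\prod_(j < n) P (U j @^-1` A j) * P (HX @^-1` C))%E.
Proof.
move=> mA mC.
have := bi_indep BI (measurable_box mA) mC.
rewrite (_ : _ @^-1` [set t | _] = [set w | forall j, A j (U j w)]); last first.
  by apply/seteqP; split => w /= h j; have := h j; rewrite tnth_mktuple.
move=> ->; congr (_ * _)%E.
have := bi_indepU BI (finset.setTfor 'I_n) mA.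
rewrite (_ : \bigcap_(_ in _) _ = [set w | forall j, A j (U j w)]); last first.
  by apply/seteqP; split => w /= h j; [apply: h; rewrite /= inE|move=> _; exact: h].
by move=> ->; apply: eq_bigl => j; rewrite inE.
Qed.

Lemma loo_independent i (A B : set _) : measurable A -> <<s loo_system i >> B ->
  P (U i @^-1` A `&` B) = (P (U i @^-1` A) * P B)%E.
Proof.
move=> mA; apply: g_sigma_algebra_independent.
- by rewrite -[X in measurable X]setTI; exact: measurable_funP.
- exact: loo_system_measurable.
- exact: loo_system_setI.
- exact: loo_system_setT.
move=> _ [D [C [mD Di mC ->]]].
(* On the pi-system, intersecting with the event U_i in A fills the free side i of the box with A,
   so the result is again a box. *)
pose D' j := if j == i then A else D j.
have mD' j : measurable (D' j) by rewrite /D'; case: ifP.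
rewrite prob_box// setIA.
rewrite (_ : U i @^-1` A `&` _ = [set w | forall j, D' j (U j w)]); last first.
  apply/seteqP; split => w /=; rewrite /preimage/= /D'.
    by move=> [Aw Dw] j; case: eqVneq => [->|_]; last exact: Dw.
  move=> h; split; first by have := h i; rewrite eqxx.
  by move=> j; have := h j; case: eqVneq => [->|_ ]; rewrite ?Di.
rewrite prob_box// muleA; congr (_ * _)%E.
rewrite (bigD1 i)//= [in RHS](bigD1 i)//= Di preimage_setT probability_setT mul1e.
rewrite {1}/D' eqxx; congr (_ * _)%E.
by apply: eq_bigr => j /negbTE ji; rewrite /D' ji.
Qed.

Lemma measurable_sub_loo d' (E : measurableType d') i (f : T -> E) :
  measurable_fun (setT : set (g_sigma_algebraType (loo_system i))) f ->
  measurable_fun setT f.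
Proof.
move=> mf _ A mA; have := mf measurableT _ mA; apply: smallest_sub.
  exact: sigma_algebra_measurable.
exact: loo_system_measurable.
Qed.

End BasicIndependenceModel.

(** * The FDR identity and the resulting bound *)

Section FDRIdentity.
Context d (T : measurableType d) (R : realType) (P : probability T R) (n : nat).
Variables (H : 'I_n -> {RV P >-> bool}) (xi U : 'I_n -> {RV P >-> R}).
Hypothesis BI : basic_independence P H xi U.
Variables (alpha lambda : R) (n0 : tail_path lambda -> R).
Hypotheses (alpha0 : 0 < alpha) (lambda0 : 0 < lambda) (lambda1 : lambda <= 1).
Hypothesis mn0 : measurable_estimator n0.

Let p := pvalue H xi U.

Lemma pvalue_true i w : ~~ H i w -> p w i = U i w.
Proof. by rewrite /p /pvalue => /negbTE->; rewrite subr0 mul1r mul0r addr0. Qed.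

(** The sigma-algebra is left arbitrary because two are used: the full one, and the one generated by
    [loo_system]. *)
Let measurable_pvalue_expr d' (S : measurableType d') (h : S -> bool) (x u : S -> R) :
  measurable_fun setT h -> measurable_fun setT x -> measurable_fun setT u ->
  measurable_fun setT (fun w => (1 - (h w)%:R) * u w + (h w)%:R * x w).
Proof.
move=> mh mx mu; have mhR : measurable_fun setT (fun w => (h w)%:R : R).
  exact/measurable_natr/measurable_nat_of_bool.
apply: measurable_funD; apply: measurable_funM => //.
exact: measurable_funB.
Qed.

Lemma measurable_pvalue j : measurable_fun setT (fun w => p w j).
Proof. by apply: measurable_pvalue_expr; exact: measurable_funP. Qed.

Section leave_one_out.
Variable i : 'I_n.
Let S : measurableType _ := g_sigma_algebraType (loo_system H xi U i).

Let k w : R := (~~ H i w)%:R / (loo_nreject alpha n0 i (p w))%:R.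
Let g w : R := loo_threshold alpha n0 i (p w).

Let mp j : j != i -> measurable_fun (setT : set S) (fun w => p w j).
Proof.
move=> ji; apply: measurable_pvalue_expr.
- exact: measurable_loo_H.
- exact: measurable_loo_xi.
- exact: measurable_loo_U.
Qed.

Let mk : measurable_fun (setT : set S) k.
Proof.
apply: measurable_funM.
  apply/measurable_natr/measurable_nat_of_bool/measurable_neg.
  exact: measurable_loo_H.
apply: measurable_funV_gt0 => [|w]; last by rewrite ltr0n loo_nreject_gt0.
by apply/measurable_natr; exact: measurable_loo_nreject.
Qed.

Let mg : measurable_fun (setT : set S) g.
Proof. exact: measurable_loo_threshold. Qed.

Let k0 w : 0 <= k w. Proof. by rewrite divr_ge0. Qed.

Let g01 w : 0 <= g w <= 1.
Proof. by rewrite loo_threshold_ge0// (le_trans _ lambda1)// loo_threshold_le. Qed.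

Lemma measurable_loo_fdp :
  measurable_fun setT (fun w => k w * (p w i <= g w)%R%:R).
Proof.
apply: measurable_funM; first exact: measurable_sub_loo mk.
apply/measurable_natr/measurable_nat_of_bool/measurable_fun_ler.
  exact: measurable_pvalue.
exact: measurable_sub_loo mg.
Qed.

Lemma measurable_loo_weight :
  measurable_fun setT (fun w => lambda^-1 * (k w * g w) * (p w i <= lambda)%R%:R).
Proof.
apply: measurable_funM; first apply: measurable_funM => //.
  exact: measurable_sub_loo (measurable_funM mk mg).
apply/measurable_natr/measurable_nat_of_bool/measurable_fun_ler => //.
exact: measurable_pvalue.
Qed.

(** Both sides equal the expectation of k * g. The left one integrates U_i out against the threshold
    g; the right one against the constant threshold lambda, whose probability cancels the factor 1 /
    lambda. *)
Lemma expectation_loo :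
  ('E_P[fun w => (k w * (p w i <= g w)%R%:R)%R] =
   'E_P[fun w => (lambda^-1 * (k w * g w) * (p w i <= lambda)%R%:R)%R])%E.
Proof.
(* The weight k vanishes unless null hypothesis i is true, and then p_i = U_i. *)
have kU (t : T -> R) w : k w * (p w i <= t w)%R%:R = k w * (U i w <= t w)%R%:R.
  rewrite /k; have [Hw|_] := boolP (~~ H i w); last by rewrite !mul0r.
  by rewrite pvalue_true.
have -> : (fun w => k w * (p w i <= g w)%R%:R) =
    (fun w => k w * (U i w <= g w)%R%:R) by apply/funext => w; exact: (kU g).
have -> : (fun w => lambda^-1 * (k w * g w) * (p w i <= lambda)%R%:R) =
    (fun w => lambda^-1 * (k w * g w) * (U i w <= lambda)%R%:R).
  apply/funext => w.
  by rewrite (mulrC (k w)) mulrA -!(mulrA _ (k w)) (kU (fun=> lambda)).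
rewrite (expectation_uniform_threshold (G := loo_system H xi U i))//; first last.
- by move=> A B; exact: loo_independent.
- exact: loo_system_measurable.
- exact: bi_uniform BI i.
rewrite (expectation_uniform_threshold (G := loo_system H xi U i)
  (f := fun w => lambda^-1 * (k w * g w)) (g := cst lambda)); first last.
- by move=> _ /=; rewrite lambda1 ltW.
- move=> w; rewrite !mulr_ge0 ?invr_ge0 ?(ltW lambda0)//.
  by case/andP: (g01 w).
- exact: measurable_cst.
- by apply: measurable_funM => //; exact: measurable_funM.
- by move=> A B; exact: loo_independent.
- exact: loo_system_measurable.
- exact: bi_uniform BI i.
by congr expectation; apply/funext => w /=; field; rewrite gt_eqF.
Qed.

End leave_one_out.

Hypothesis n0_gt0 : forall w, 0 < n0 (ecdf_tail lambda (p w)).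

Let N w := n0 (ecdf_tail lambda (p w)).

Definition fdr_weight w : R := if nreject (p w) lambda == 0 then 0 else
  nfalse (H^~ w) (p w) lambda *
    Num.min (1 / N w) (lambda / (nreject (p w) lambda * alpha)).

Lemma fdr_weight_ge0 w : 0 <= fdr_weight w.
Proof.
rewrite /fdr_weight; case: ifP => // _.
rewrite mulr_ge0 ?sumr_ge0// le_min divr_ge0 ?(ltW (n0_gt0 w))//=.
by rewrite divr_ge0 ?(ltW lambda0)// mulr_ge0 ?(ltW alpha0)// nrejectE.
Qed.

Lemma measurable_fdr_weight : measurable_fun setT fdr_weight.
Proof.
(* Rescaling brings in the factor alpha / lambda, with which the weight is a finite sum of terms
   already known to be measurable. *)
rewrite (_ : fdr_weight = fun w => (lambda / alpha) * (alpha / lambda * fdr_weight w)).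
  apply: measurable_funM => //.
  under eq_fun => w do rewrite (nfalse_weightE alpha0 lambda0 (n0_gt0 w)).
  by apply: measurable_sum => i; exact: measurable_loo_weight.
by apply/funext => w; field; rewrite !gt_eqF.
Qed.

(** Once alpha / lambda is inside the expectation, both integrands are sums over i, and their terms
    have equal expectations although they differ pointwise. *)
Lemma FDR_weightE :
  (FDR P alpha n0 H xi U = (alpha / lambda)%:E * 'E_P[fdr_weight])%E.
Proof.
have -> : ((alpha / lambda)%:E * 'E_P[fdr_weight] =
    'E_P[fun w => (alpha / lambda * fdr_weight w)%R])%E.
  rewrite unlock -ge0_integralZl_EFin//.
  - by move=> w _; rewrite lee_fin fdr_weight_ge0.
  - exact/measurable_EFinP/measurable_fdr_weight.
  - by rewrite divr_ge0 ?ltW.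
rewrite /FDR -/p.
under eq_fun => w do rewrite (adaptive_fdpE alpha0 lambda0 (n0_gt0 w)).
under [in RHS]eq_fun => w do rewrite (nfalse_weightE alpha0 lambda0 (n0_gt0 w)).
rewrite !expectation_sum_ge0.
- by apply: eq_bigr => i _; exact: expectation_loo.
- exact: measurable_loo_weight.
- move=> i w; rewrite !mulr_ge0 ?invr_ge0 ?(ltW lambda0)//.
  exact: loo_threshold_ge0.
- exact: measurable_loo_fdp.
- by move=> i w; rewrite !mulr_ge0 ?invr_ge0.
Qed.

Lemma fdr_weight_le w : fdr_weight w <= nfalse (H^~ w) (p w) lambda / N w.
Proof.
have V0 : 0 <= nfalse (H^~ w) (p w) lambda by rewrite sumr_ge0.
rewrite /fdr_weight; case: ifP => _; first by rewrite divr_ge0 ?(ltW (n0_gt0 w)).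
by rewrite ler_wpM2l// ge_min mul1r lexx.
Qed.

Lemma expectation_fdr_weight_le :
  ('E_P[fdr_weight] <=
   'E_P[fun w => (nfalse (H^~ w) (p w) lambda / N w)%R])%E.
Proof.
rewrite unlock; apply: ge0_le_integral => //.
- by move=> w _; rewrite lee_fin fdr_weight_ge0.
- exact/measurable_EFinP/measurable_fdr_weight.
- apply/measurable_EFinP/measurable_funM; last first.
    apply: measurable_funV_gt0 => //; apply: measurable_estimator_comp => //.
    exact: measurable_pvalue.
  apply: measurable_sum => i; apply/measurable_natr/measurable_nat_of_bool.
  apply: measurable_and.
    by apply: measurable_fun_ler => //; exact: measurable_pvalue.
  by apply: measurable_neg; exact: measurable_funP.
- by move=> w _; rewrite lee_fin fdr_weight_le.
Qed.

End FDRIdentity.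

Theorem theorem1 (d : measure_display) (T : measurableType d) (R : realType)
    (P : probability T R) (n : nat) (hn : (0 < n)%N)
    (H : 'I_n -> {RV P >-> bool}) (xi U : 'I_n -> {RV P >-> R})
    (hBI : basic_independence P H xi U)
    (alpha lambda : R) (halpha : 0 < alpha) (hal : alpha < lambda)
    (hlambda : lambda < 1)
    (n0 : tail_path lambda -> R)
    (hn0 : measurable_estimator n0)
    (hn0_gt0 : forall w : T, 0 < n0 (ecdf_tail lambda (pvalue H xi U w))) :
  let p := pvalue H xi U in
  let hat_n0 := fun w => n0 (ecdf_tail lambda (p w)) in
  let V := fun w => nfalse (H^~ w) (p w) lambda in
  let Rl := fun w => nreject (p w) lambda in
  let W := fun w => if Rl w == 0 then 0 else
    V w * Num.min (1 / hat_n0 w) (lambda / (Rl w * alpha)) in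
  (FDR P alpha n0 H xi U = (alpha / lambda)%:E * 'E_P[W])%E /\
  (('E_P[fun w => (V w / hat_n0 w)%R] <= lambda%:E)%E ->
    (FDR P alpha n0 H xi U <= alpha%:E)%E).
Proof.
move=> p hat_n0 V Rl W.
have lambda0 : 0 < lambda by exact: lt_trans hal.
have FDRE := FDR_weightE hBI halpha lambda0 (ltW hlambda) hn0 hn0_gt0.
split=> // EV; rewrite FDRE.
(* Factoring alpha as (alpha / lambda) * lambda reduces the claim to E(W) <= lambda, which follows
   by bounding the minimum by 1 / [hat_n0]. *)
rewrite -[leRHS](_ : ((alpha / lambda)%:E * lambda%:E = alpha%:E)%E); last first.
  by rewrite -EFinM divfK ?gt_eqF.
apply: lee_wpmul2l; first by rewrite lee_fin divr_ge0 ?ltW.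
exact: le_trans (expectation_fdr_weight_le halpha lambda0 hn0 hn0_gt0) EV.
Qed.
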